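(* Let $\Lambda\subset\Lambda'$ be Fitting orders over a Fitting domain $\mathfrak{o}$ in an algebra $A$, such that $\Lambda'$ is a maximal order, and let $M$ be a finitely generated $\Lambda$-module. Then $\mathcal{F}(\zeta(\Lambda'),\zeta(\Lambda))\subset\mathcal{H}(\Lambda)$ and so $$\mathcal{F}(\zeta(\Lambda'),\zeta(\Lambda))\cdot\mathrm{Fit}^{\max}_{\Lambda}(M)\subset\mathrm{Ann}_{\zeta(\Lambda)}(M).$$
   Context: Modules are left modules; $\zeta(\cdot)$ denotes the centre of a ring. A Fitting domain is an integrally closed complete commutative noetherian local domain $\mathfrak{o}$; let $F$ be its field of quotients. A Fitting order over $\mathfrak{o}$ is an $\mathfrak{o}$-order $\Lambda$ in a (finite dimensional) separable $F$-algebra $A$. Conductor of centres: $\mathcal{F}(\zeta(\Lambda'),\zeta(\Lambda)) := \{x\in\zeta(\Lambda')\mid x\,\zeta(\Lambda')\subset\zeta(\Lambda)\}$. Let $e_1,\dots,e_t$ be the central primitive idempotents of $A$, $A_i = Ae_i \simeq M_{n_i\times n_i}(D_i)$ with $D_i$ a skewfield, $F_i = \zeta(A_i)=\zeta(D_i)$, $[D_i:F_i]=s_i^2$. The reduced norm $\mathrm{nr}: M_{b\times b}(A)\to \zeta(A) = \bigoplus_i F_i$ is defined componentwise. Generalised adjoint: for $H\in M_{b\times b}(\Lambda)$ put $H_i = He_i$, $m_i = n_i s_i b$, let $f_i(X)=\sum_{j=0}^{m_i}\alpha_{ij}X^j$ be the reduced characteristic polynomial of $H_i$ (over $F_i$;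 its coefficients lie in the integral closure of $\mathfrak{o}$ in $F_i$), and set $H_i^{\ast} := (-1)^{m_i+1}\sum_{j=1}^{m_i}\alpha_{ij}H_i^{j-1}$ (with $H_i^0$ the identity of $M_{b\times b}(A_i)$), $H^{\ast} := \sum_{i=1}^t H_i^{\ast}$; then $H^\ast H = HH^\ast = \mathrm{nr}(H)\cdot 1_{b\times b}$. Put $$\mathcal{H}(\Lambda) := \{x\in\zeta(\Lambda)\mid xH^{\ast}\in M_{b\times b}(\Lambda)\ \text{for all } H\in M_{b\times b}(\Lambda) \text{ and all } b\in\mathbb{N}\}.$$ Put $\mathcal{U}(\Lambda) := \langle \mathrm{nr}(H) \mid H \in \mathrm{GL}_b(\Lambda), b\in\mathbb{N}\rangle_{\zeta(\Lambda)} \subset \zeta(A)$. For a finite presentation $\Lambda^a \xrightarrow{h} \Lambda^b \twoheadrightarrow M$, identify $h$ with a matrix in $M_{a\times b}(\Lambda)$ (acting by right multiplication on row vectors), let $S_b(h)$ be the set of its $b\times b$ submatrices when $a\ge b$, and put $\mathrm{Fit}_\Lambda(h) := \langle \mathrm{nr}(H) \mid H\in S_b(h)\rangle_{\mathcal{U}(\Lambda)}$ if $a\ge b$ and $\mathrm{Fit}_\Lambda(h) := 0$ if $a<b$. Then $\mathrm{Fit}^{\max}_\Lambda(M)$ is the unique maximal element with respect to inclusion (which exists) among all $\mathrm{Fit}_\Lambda(h)$, $h$ running through the finite presentations of $M$. *)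

(* Defs.v *)
From HB Require Import structures.
From mathcomp Require Import all_boot all_order all_algebra all_field.
From mathcomp Require Import all_classical.

Set Implicit Arguments.
Unset Strict Implicit.
Unset Printing Implicit Defensive.

Import GRing.Theory.
Local Open Scope classical_set_scope.
Local Open Scope ring_scope.

(* Finite sums of products s * x with s in S and x in X: this is the module
   <X>_S generated by X over a subring S, and the product S . X of two ideals. *)
Definition gen_span (R : pzRingType) (S X : set R) : set R :=
  [set y | exists (n : nat) (s x : 'I_n -> R),
     [/\ forall i, S (s i), forall i, X (x i) & y = \sum_(i < n) s i * x i]].

Definition ring_center (R : pzRingType) (S : set R) : set R :=
  [set x | S x /\ forall y, S y -> x * y = y * x].

Definition is_ideal (o : comNzRingType) (I : set o) : Prop :=
  [/\ I 0, forall x y, I x -> I y -> I (x + y) & forall a x, I x -> I (a * x)].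

Definition noetherian (o : comNzRingType) : Prop :=
  forall I : set o, is_ideal I ->
  exists g : seq o, I = gen_span [set: o] [set` g].

Definition nonunits (o : idomainType) : set o :=
  [set x | x \isn't a GRing.unit].

Definition local_domain (o : idomainType) : Prop := is_ideal (@nonunits o).

Fixpoint ideal_pow (o : comNzRingType) (I : set o) (n : nat) : set o :=
  if n is n'.+1 then gen_span I (ideal_pow I n') else [set: o].

(* The canonical map from o to the inverse limit of the o / I^n is injective
   and surjective. *)
Definition adic_complete (o : comNzRingType) (I : set o) : Prop :=
  (forall x, (forall n, ideal_pow I n x) -> x = 0) /\
  (forall u : nat -> o, (forall n, ideal_pow I n (u n.+1 - u n)) ->
     exists l, forall n, ideal_pow I n (l - u n)).

Definition integrally_closed (o : idomainType) : Prop :=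
  forall x : {fraction o}, integralOver (@tofrac o) x ->
  exists r : o, x = tofrac r.

Definition fitting_domain (o : idomainType) : Prop :=
  [/\ integrally_closed o, noetherian o, local_domain o
    & adic_complete (@nonunits o)].

Definition central_prim_idem (R : pzRingType) : set R :=
  [set e | [/\ ring_center [set: R] e, e * e = e, e != 0
             & forall d, ring_center [set: R] d -> d * d = d -> d * e = d ->
                 d = 0 \/ d = e]].
Arguments central_prim_idem R : clear implicits.

(* Left ideals of a finite dimensional unital algebra are vector subspaces. *)
Definition semisimple (F : fieldType) (A : falgType F) : Prop :=
  forall U : {vspace A}, ({:A} * U <= U)%VS ->
  exists W : {vspace A},
    [/\ ({:A} * W <= W)%VS, (U + W)%VS = fullv & (U :&: W)%VS = 0%VS].

(* A is semisimple, and the centre Z(A)e of each simple component Ae is a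
   separable field extension of F (embedded in Ae as F e): for central z, the
   value at ze of p, computed in Ae, is p(z) e. *)
Definition separable_algebra (F : fieldType) (A : falgType F) : Prop :=
  semisimple A /\
  forall e z : A, central_prim_idem A e -> ring_center [set: A] z ->
  exists p : {poly F}, separable_poly p /\ horner_alg z p * e = 0.

(* o-orders in A, where A is an algebra over the quotient field of o. *)
Definition is_order (o : idomainType) (A : falgType {fraction o})
    (L : set A) : Prop :=
  [/\ [/\ L 1, forall x y, L x -> L y -> L (x - y)
         & forall x y, L x -> L y -> L (x * y)],
      exists g : seq A,
        L = gen_span (range (fun r : o => (tofrac r)%:A)) [set` g]
    & gen_span (range (fun c : {fraction o} => c%:A)) L = [set: A]].

Definition is_maximal_order (o : idomainType) (A : falgType {fraction o})
    (L : set A) : Prop :=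
  is_order L /\ forall L' : set A, is_order L' -> L `<=` L' -> L' = L.

Definition conductor (R : pzRingType) (Z' Z : set R) : set R :=
  [set x | Z' x /\ forall y, Z' y -> Z (x * y)].

(* phi is a splitting representation of the central simple algebra Ae over
   its centre Z(A)e.  A unital morphism on A with phi e = 1 is the same as a
   unital morphism on Ae, as it kills A(1 - e).  The centre goes to scalars,
   which makes E an extension field of Z(A)e; the induced E-linear map
   E (x)_{Z(A)e} Ae -> M_m(E) is onto, and the dimension condition
   [Ae : Z(A)e] = m^2 then makes it an isomorphism. *)
Definition splitting_repr (F : fieldType) (A : falgType F) (e : A)
    (E : fieldType) (m : nat) (phi : {rmorphism A -> 'M[E]_m}) : Prop :=
  [/\ phi e = 1,
      forall z, ring_center [set: A] z -> is_scalar_mx (phi z),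
      forall B : 'M[E]_m, exists (n : nat) (c : 'I_n -> E) (a : 'I_n -> A),
        B = \sum_(i < n) c i *: phi (a i)
    & \dim (<[e]> * {:A}) = (m ^ 2 * \dim (<[e]> * 'Z({:A})%VS))%N].

(* f is the reduced characteristic polynomial of He over the field Z(A)e, whose
   elements are viewed in A, so that the leading coefficient of f is e. *)
Definition is_red_char_poly (F : fieldType) (A : falgType F) (e : A)
    (b : nat) (H : 'M[A]_b) (f : {poly A}) : Prop :=
  exists (E : fieldType) (m : nat) (phi : {rmorphism A -> 'M[E]_m}),
    splitting_repr e phi /\
    forall j : nat,
      [/\ ring_center [set: A] f`_j, f`_j * e = f`_j
        & phi f`_j =
          ((char_poly (\mxblock_(i < b, k < b) phi (H i k)))`_j)%:M].

(* Ae has splitting representations, and the polynomial does not depend on the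
   one used, so the default value 0 is never taken. *)
Definition red_char_poly (F : fieldType) (A : falgType F) (e : A)
    (b : nat) (H : 'M[A]_b) : {poly A} :=
  xget 0 [set f | is_red_char_poly e H f].

Definition red_deg (F : fieldType) (A : falgType F) (e : A)
    (b : nat) (H : 'M[A]_b) : nat := (size (red_char_poly e H)).-1.

Definition red_norm_comp (F : fieldType) (A : falgType F) (e : A)
    (b : nat) (H : 'M[A]_b) : A :=
  (-1) ^+ red_deg e H * (red_char_poly e H)`_0.

Definition red_norm (F : fieldType) (A : falgType F)
    (b : nat) (H : 'M[A]_b) : A :=
  \sum_(e \in central_prim_idem A) red_norm_comp e H.

(* Coefficients of the reduced characteristic polynomial lie in Ae, so the
   identity matrix (e *: H) ^+ 0 of M_b(A) acts here as that of M_b(Ae). *)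
Definition gen_adjoint_comp (F : fieldType) (A : falgType F) (e : A)
    (b : nat) (H : 'M[A]_b) : 'M[A]_b :=
  (-1) ^+ (red_deg e H).+1 *:
  \sum_(1 <= j < (red_deg e H).+1)
     (red_char_poly e H)`_j *: ((e *: H) ^+ j.-1).

Definition gen_adjoint (F : fieldType) (A : falgType F)
    (b : nat) (H : 'M[A]_b) : 'M[A]_b :=
  \sum_(e \in central_prim_idem A) gen_adjoint_comp e H.

Definition mx_over (R : pzRingType) (L : set R) (m n : nat)
    (H : 'M[R]_(m, n)) : Prop := forall i j, L (H i j).

Definition adjoint_ideal (F : fieldType) (A : falgType F)
    (L : set A) : set A :=
  [set x | ring_center L x /\
     forall (b : nat) (H : 'M[A]_b),
       mx_over L H -> mx_over L (x *: gen_adjoint H)].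

Definition GL_over (R : pzRingType) (L : set R) (b : nat) : set 'M[R]_b :=
  [set H | mx_over L H /\
     exists G : 'M[R]_b, [/\ mx_over L G, H *m G = 1%:M & G *m H = 1%:M]].

Definition nr_units (F : fieldType) (A : falgType F) (L : set A) : set A :=
  gen_span (ring_center L)
    [set x | exists (b : nat) (H : 'M[A]_b), GL_over L H /\ x = red_norm H].

(* From here on the order is the image of an injective ring morphism
   iota : Lam -> A, so that modules over it are those over the ring Lam. *)

Definition fg_module (R : nzRingType) (M : lmodType R) : Prop :=
  exists (n : nat) (g : 'I_n -> M),
  forall x, exists c : 'I_n -> R, x = \sum_(i < n) c i *: g i.

Definition presents (R : nzRingType) (M : lmodType R) (a b : nat)
    (h : 'M[R]_(a, b)) : Prop :=
  exists p : {linear 'rV[R]_b -> M},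
    (forall x, exists v, p v = x) /\
    (forall v, p v = 0 <-> exists u : 'rV[R]_a, v = u *m h).

Definition Fit_pres (F : fieldType) (A : falgType F) (Lam : nzRingType)
    (iota : {rmorphism Lam -> A}) (a b : nat) (h : 'M[Lam]_(a, b)) : set A :=
  if (b <= a)%N then
    gen_span (nr_units (range iota))
      [set x | exists s : 'I_b -> 'I_a,
         (forall i j : 'I_b, (i < j)%N -> (s i < s j)%N) /\
         x = red_norm (map_mx iota (rowsub s h))]
  else [set 0].

(* A maximal Fit_pres exists and is unique, since o is complete; the default
   value [set 0] is not taken. *)
Definition Fit_max (F : fieldType) (A : falgType F) (Lam : nzRingType)
    (iota : {rmorphism Lam -> A}) (M : lmodType Lam) : set A :=
  let Fits : set (set A) :=
    [set I | exists (a b : nat) (h : 'M[Lam]_(a, b)),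
       presents M h /\ I = Fit_pres iota h] in
  xget [set 0] [set I | Fits I /\ forall J, Fits J -> I `<=` J -> J = I].

Definition center_annihilator (F : fieldType) (A : falgType F)
    (Lam : nzRingType) (iota : {rmorphism Lam -> A}) (M : lmodType Lam) :
    set A :=
  iota @` [set z | ring_center [set: Lam] z /\ forall x : M, z *: x = 0].

(* Main.v *)
(* Let H be a square matrix over the order L. Since L is a finitely generated
   o-module, H is integral over o, hence so are the eigenvalues of its image
   under a splitting representation and the coefficients of its reduced
   characteristic polynomials. These coefficients are central, and a maximal
   order contains every central integral element, so they lie in the centre of
   L'. Multiplied by an element x of the conductor they fall into the centre of
   L, whence x H^* has entries in L. By Cayley-Hamilton H^* H = nr(H), so x
     nr(H)
   is a left multiple of H over L;
     if H consists of rows of a presentation matrix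
   h of M, then x nr(H) sends all row vectors into the row space of h and thus
   annihilates M. The reduced norms of units and the centre of L only multiply x
   by elements of the centre of L', which preserves the conductor. *)

From HB Require Import structures.
Require Import Defs.
From mathcomp Require Import all_boot all_order all_algebra all_field.
From mathcomp Require Import all_classical.

Set Implicit Arguments.
Unset Strict Implicit.
Unset Printing Implicit Defensive.

Import GRing.Theory.
Local Open Scope classical_set_scope.
Local Open Scope ring_scope.

(** * Integrality of the coefficients of characteristic polynomials *)

Lemma irreducible_dvdp (K : fieldType) (p : {poly K}) :
  (1 < size p)%N -> exists2 r, irreducible_poly r & r %| p.
Proof.
have [n] := ubnP (size p); elim: n p => // n IHn p ltpn p1.
case: (pselect (irreducible_poly p)) => [ip|nip]; first by exists p.
have [r [r1 rp nrp]] : exists r :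
  {poly K}, [/\ size r != 1%N, r %| p & ~~ (r %= p)].
  apply: contra_notP nip => nex; split=> // r r1 rp.
  by apply/negPn/negP => nrp; apply: nex; exists r.
have p0 : p != 0 by rewrite -size_poly_gt0; case: (size p) p1.
have r0 : r != 0 by apply: contraNneq p0 => r0; move: rp; rewrite r0 dvd0p.
have ltrp : (size r < size p)%N.
  by rewrite ltn_neqAle dvdp_leq // andbT dvdp_size_eqp.
have [s irs sr] : exists2 s, irreducible_poly s & s %| r.
  apply: IHn; first exact: leq_trans ltrp _.
  by rewrite ltn_neqAle eq_sym r1 size_poly_gt0.
by exists s => //; apply: dvdp_trans rp.
Qed.

(** Adjoin a root [z] of an irreducible factor, split off ['X - z%:P] and continue over the larger
    field; the induction is on a bound for the size because the field changes. *)
Lemma splitting_extension (K : fieldType) (p : {poly K}) : p \is monic ->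
  exists (L : fieldType) (f : {rmorphism K -> L}) (s : seq L),
    map_poly f p = \prod_(a <- s) ('X - a%:P).
Proof.
have [n] := ubnP (size p); elim: n K p => // n IHn K p ltpn mp.
have [p1|p1] := leqP (size p) 1.
  exists K, idfun, [::]; rewrite big_nil map_poly_id //.
  by have := size1_polyC p1 => Ep; move: mp; rewrite Ep monicE lead_coefC =>
    /eqP ->.
have [r ir rp] := irreducible_dvdp p1.
have [L _ [z rz _]] := irredp_FAdjoin ir.
pose f : {rmorphism K -> L} := in_alg L.
have /factor_theorem[q Dp] : root (map_poly f p) z.
  by rewrite -(divpK rp) rmorphM rootM rz orbT.
have mq : q \is monic.
  have: map_poly f p \is monic by rewrite map_monic.
  by rewrite Dp monicMr // monicXsubC.
have q0 : q != 0 by exact: monic_neq0.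
have ltqn : (size q < n)%N.
  have := size_map_poly f p; rewrite Dp size_Mmonic ?monicXsubC // size_XsubC.
  by rewrite addn2 /= => Ep; move: ltpn; rewrite -Ep ltnS.
have [L' [g [s Dq]]] := IHn L q ltqn mq.
exists L', (g \o f), (g z :: s).
rewrite map_poly_comp /= Dp rmorphM /= Dq big_cons mulrC.
by rewrite rmorphB /= map_polyX map_polyC.
Qed.

Lemma Cayley_Hamilton_sum (K : comNzRingType) (n : nat) (N : 'M[K]_n) (d : nat) :
  (size (char_poly N) <= d)%N ->
  \sum_(j < d) (char_poly N)`_j *: N ^+ j = 0.
Proof.
case: n N => [|n] N led; first by apply/matrixP => -[].
have := Cayley_Hamilton N; rewrite /horner_mx /horner_morph horner_coef => E0.
rewrite -[RHS]E0 (big_ord_widen d (fun j =>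
  (map_poly scalar_mx (char_poly N))`_j * N ^+ j)); last first.
  by rewrite (leq_trans _ led) ?size_poly.
rewrite [RHS]big_mkcond; apply: eq_bigr => j _ /=.
rewrite coef_map /= -mul_scalar_mx; case: ltnP => // lej.
have := nth_default 0 lej; rewrite coef_map /=.
by move=> ->; rewrite mul0mx.
Qed.

Lemma integral_prod_XsubC (R K : comNzRingType) (psi : {rmorphism R -> K})
    (s : seq K) :
  (forall a, a \in s -> integralOver psi a) ->
  forall j, integralOver psi (\prod_(a <- s) ('X - a%:P))`_j.
Proof.
elim: s => [|a s IHs] int_s j.
  by rewrite big_nil coef1; exact: integral_nat.
have int_a : integralOver psi a by apply: int_s; rewrite mem_head.
have {}IHs : forall i, integralOver psi (\prod_(b <- s) ('X - b%:P))`_i.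
  by apply: IHs => b bs; apply: int_s; rewrite in_cons bs orbT.
rewrite big_cons mulrBl coefB coefXM coefCM.
apply: integral_sub; last exact: integral_mul.
by case: eqP => _; [exact: integral0 | exact: IHs].
Qed.

(** The eigenvalues of [N] in a splitting field are roots of [q], hence integral, and the
    coefficients are polynomial expressions in them. *)
Lemma integral_char_poly (R : comNzRingType) (K : fieldType)
    (psi : {rmorphism R -> K}) (n : nat) (N : 'M[K]_n) (q : {poly R}) :
  q \is monic -> \sum_(j < size q) psi q`_j *: N ^+ j = 0 ->
  forall i, integralOver psi (char_poly N)`_i.
Proof.
move=> mq qN i.
have [L [f [s Ds]]] := splitting_extension (char_poly_monic N).
(* An integral equation for an element of [K] that holds in [L] holds in [K], as [f] is
   injective. *)
suff [r mr rr] : integralOver (f \o psi) (f (char_poly N)`_i).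
  exists r => //; move: rr; rewrite map_poly_comp /root horner_map /=.
  by rewrite fmorph_eq0.
rewrite -coef_map Ds; apply: integral_prod_XsubC => a a_s.
have : eigenvalue (map_mx f N) a.
  by rewrite eigenvalue_root_char -map_char_poly /= Ds root_prod_XsubC.
case/eigenvalueP => v vN v0.
have vNk k : v *m (map_mx f N) ^+ k = a ^+ k *: v.
  elim: k => [|k IHk]; first by rewrite !expr0 mulmx1 scale1r.
  by rewrite exprS mulmxA vN -scalemxAl IHk scalerA -exprS.
(* For the eigenvector [v], [q(a) v = v q(N) = 0] forces [q(a) = 0]. *)
exists q => //; apply/rootP; apply: contraNeq v0 => qa.
apply/eqP; apply: (scalerI qa); rewrite scaler0.
rewrite (@horner_coef_wide _ (size q)) ?size_poly // scaler_suml.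
transitivity (v *m map_mx f (\sum_(j < size q) psi q`_j *: N ^+ j)); last first.
  by rewrite qN map_mx0 mulmx0.
rewrite map_mx_sum mulmx_sumr; apply: eq_bigr => j _.
rewrite coef_map /= map_mxZ -scalemxAr -scalerA -vNk; congr (_ *: (_ *m _)).
by elim: {qN vNk}(nat_of_ord j) => [|k IHk];
  rewrite ?expr0 ?map_mx1 // !exprS map_mxM IHk.
Qed.

(** * Spans and central scalars *)

Lemma gen_span0 (R : pzRingType) (S X : set R) : gen_span S X 0.
Proof. by exists 0%N, (fun=> 0), (fun=> 0); split=> [[]|[]|] //;
  rewrite big_ord0. Qed.

Lemma gen_spanM (R : pzRingType) (S X : set R) (s x : R) :
  S s -> X x -> gen_span S X (s * x).
Proof. by move=> Ss Xx; exists 1%N, (fun=> s), (fun=> x); split=> //;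
  rewrite big_ord1. Qed.

Lemma gen_spanD (R : pzRingType) (S X : set R) (y z : R) :
  gen_span S X y -> gen_span S X z -> gen_span S X (y + z).
Proof.
move=> [m [s [x [Ss Xx ->]]]] [n [t [w [St Xw ->]]]].
exists (m + n)%N, (fun i => match fintype.split i with inl j =>
  s j | inr j => t j end),
  (fun i => match fintype.split i with inl j => x j | inr j => w j end).
split=> [i|i|]; [by case: (fintype.split i)|by case: (fintype.split i)|].
rewrite big_split_ord /=; congr (_ + _); apply: eq_bigr => j _.
  by rewrite (unsplitK (inl j)).
by rewrite (unsplitK (inr j)).
Qed.

Lemma gen_span_sub (R : pzRingType) (S X T : set R) :
  T 0 -> (forall y z, T y -> T z -> T (y + z)) ->
  (forall s x, S s -> X x -> T (s * x)) -> gen_span S X `<=` T.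
Proof. by move=> T0 TD TM y [n [s [x [Ss Xx ->]]]]; apply: big_ind => // i _;
  apply: TM. Qed.

Lemma gen_span_sum (R : pzRingType) (S X : set R) (I : Type) (r : seq I) (f : I -> R) :
  (forall i, gen_span S X (f i)) -> gen_span S X (\sum_(i <- r) f i).
Proof. by move=> Sf; apply: big_ind => // *; [exact: gen_span0|exact:
  gen_spanD]. Qed.

Lemma algr_center (F : fieldType) (A : falgType F) (k : F) :
  ring_center [set: A] k%:A.
Proof. by split=> // y _; rewrite mulr_algl mulr_algr. Qed.

Lemma scalemx_central_Ar (R : nzRingType) (m n p : nat) (c : R)
    (B : 'M[R]_(m, n)) (C : 'M[R]_(n, p)) :
  ring_center [set: R] c -> c *: (B *m C) = B *m (c *: C).
Proof.
move=> [_ cc]; apply/matrixP => i j; rewrite !mxE mulr_sumr; apply: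
  eq_bigr => k _.
by rewrite !mxE !mulrA cc.
Qed.

(** * Orders, and the integrality of their matrices *)

Definition base_map (o : idomainType) (A : falgType {fraction o}) (r : o) : A :=
  (tofrac r)%:A.

HB.instance Definition _ (o : idomainType) (A : falgType {fraction o}) :=
  GRing.RMorphism.copy (@base_map o A) (in_alg A \o @tofrac o).

Section Orders.
Variables (o : idomainType) (A : falgType {fraction o}).
Implicit Types (L : set A).
Notation base_map := (@base_map o A).

Lemma base_map_center (r : o) : ring_center [set: A] (base_map r).
Proof. exact: algr_center. Qed.

(** Collecting terms by generator gives one coordinate in [o] per index; these coordinates become
    matrix entries below. *)
Lemma gen_span_seq (g : seq A) (y : A) :
  gen_span (range (fun r : o => (tofrac r)%:A)) [set` g] y ->
  exists c : 'I_(size g) -> o, y = \sum_i base_map (c i) * g`_i.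
Proof.
move: y; apply: gen_span_sub => [|y z [c ->] [d ->]|s x [r _ <-] /= gx].
- by exists (fun=> 0); rewrite big1 // => i _; rewrite rmorph0 mul0r.
- exists (fun i => c i + d i); rewrite -big_split /=; apply: eq_bigr => i _.
  by rewrite -mulrDl -rmorphD.
- have ltx : (index x g < size g)%N by rewrite index_mem.
  exists (fun i => if i == Ordinal ltx then r else 0).
  rewrite (bigD1 (Ordinal ltx)) //= eqxx nth_index // big1 ?addr0 // =>
    i /negPf ->.
  by rewrite rmorph0 mul0r.
Qed.

Lemma orderN L x : is_order L -> L x -> L (- x).
Proof.
case=> [[L1 LB _] _ _] Lx; rewrite -sub0r; apply: (LB) => //.
by rewrite -(subrr 1); apply: LB.
Qed.

Lemma order0 L : is_order L -> L 0.
Proof. by case=> [[L1 LB _] _ _]; rewrite -(subrr 1); apply: LB. Qed.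

Lemma orderD L x y : is_order L -> L x -> L y -> L (x + y).
Proof.
move=> oL Lx Ly; rewrite -[y]opprK; have [[_ LB _] _ _] := oL.
by apply: LB => //; apply: orderN.
Qed.

Lemma order_base L r : is_order L -> L (base_map r).
Proof.
move=> [[L1 _ _] [g Dg] _]; have [c E1] :=
  gen_span_seq (eq_ind _ (@^~ 1) L1 _ Dg).
rewrite -[base_map r]mulr1 E1 mulr_sumr Dg; apply: gen_span_sum => i.
rewrite mulrA -rmorphM; apply: gen_spanM; first by exists (r * c i).
by rewrite /= mem_nth.
Qed.

(** [L] spans [A] over the field of quotients, so what commutes with [L] commutes with [A]. *)
Lemma order_center L x :
  is_order L -> ring_center L x <-> L x /\ ring_center [set: A] x.
Proof.
move=> oL; split=> [[Lx cx]|[Lx [_ cx]]]; last by split=> // y _; apply: cx.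
split=> //; split=> // y _.
have : [set: A] y by [].
have [_ _ <-] := oL; move: y; apply: gen_span_sub =>
  [|y z yx zx|s y [k _ <-] Ly].
- by rewrite mulr0 mul0r.
- by rewrite mulrDl mulrDr yx zx.
- by rewrite mulr_algl -scalerAr cx // scalerAl.
Qed.

(* If g spans L over o and W = 1_b (x) g, then H W = W N with N over o, and the
   characteristic polynomial of N kills H because W has a right inverse. *)
Lemma order_mx_integral L (b : nat) (H : 'M[A]_b) :
  is_order L -> mx_over L H ->
  exists2 q : {poly o}, q \is monic &
    \sum_(j < size q) base_map q`_j *: H ^+ j = 0.
Proof.
move=> [[L1 _ LM] [g Dg] _] LH.
have Lg k : (k < size g)%N -> L g`_k.
  move=> ltk; rewrite Dg -[g`_k]mul1r; apply: gen_spanM;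
    last by rewrite /= mem_nth.
  by exists 1 => //; rewrite rmorph1 scale1r.
have /choice[r Dr] (x : 'I_b * 'I_b * 'I_(size g)) : exists c :
  'I_(size g) -> o,
    H x.1.1 x.1.2 * g`_x.2 = \sum_i base_map (c i) * g`_i.
  by apply: gen_span_seq; rewrite -Dg; apply: LM => //; apply: Lg.
have [c D1] := gen_span_seq (eq_ind _ (@^~ 1) L1 _ Dg).
pose T : finType := ('I_b * 'I_(size g))%type.
pose ev (t : 'I_#|T|) : T := enum_val t.
(* Each column of [W] has some [g_k] in one position and 0 elsewhere; column [t] of [N] lists
   coordinates of [H] times column [t] of [W]. *)
pose W : 'M[A]_(b, #|T|) :=
  \matrix_(i < b, t < #|T|) ((i == (ev t).1)%:R * g`_(ev t).2).
pose N : 'M[o]_#|T| := \matrix_(s < #|T|, t < #|T|)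
  r ((ev s).1, (ev t).1, (ev t).2) (ev s).2.
pose N' := map_mx base_map N.
(* The coordinates [c] of [1] make [C] a right inverse of [W]. *)
pose C : 'M[A]_(#|T|, b) :=
  \matrix_(t < #|T|, i < b) ((i == (ev t).1)%:R * base_map (c (ev t).2)).
have sumT (f : T -> A) : \sum_(t < #|T|) f (ev t) = \sum_i \sum_k f (i, k).
  rewrite pair_bigA /= -(big_enum_val (A := T)) /=.
  by apply: eq_big => -[].
have WC : W *m C = 1%:M.
  apply/matrixP => i i'; rewrite !mxE.
  under eq_bigr do rewrite !mxE.
  rewrite (sumT (fun t =>
    (i == t.1)%:R * g`_t.2 * ((i' == t.1)%:R * base_map (c t.2)))).
  rewrite (bigD1 i) //= [X in _ + X]big1 => [|k /negPf ik]; last first.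
    by rewrite big1 // => l _; rewrite eq_sym ik !mul0r.
  rewrite addr0 eqxx; case: (eqVneq i i') => [_|_]; last first.
    by rewrite big1 // => l _; rewrite mul0r mulr0.
  rewrite -[RHS]/(1 : A) [RHS]D1; apply: eq_bigr => k _.
  by rewrite !mul1r; have [_ ->] := base_map_center (c k).
have HW : H *m W = W *m N'.
  apply/matrixP => i t; rewrite !mxE (bigD1 (ev t).1) //= [X in _ + X]big1 =>
    [|k /negPf ik].
    rewrite !mxE eqxx mul1r addr0.
    rewrite (Dr (i, (ev t).1, (ev t).2)).
    under [RHS]eq_bigr do rewrite !mxE.
    rewrite (sumT (fun s => (i == s.1)%:R * g`_s.2 *
      base_map (r (s.1, (ev t).1, (ev t).2) s.2))).
    rewrite (bigD1 i) //= [X in _ + X]big1 => [|k /negPf ik]; last first.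
      by rewrite big1 // => l _; rewrite eq_sym ik !mul0r.
    rewrite addr0 eqxx; apply: eq_bigr => k _; rewrite mul1r.
    by have [_ ->] := base_map_center (r (i, (ev t).1, (ev t).2) k).
  by rewrite mxE ik mul0r mulr0.
have HkW k : H ^+ k *m W = W *m N' ^+ k.
  elim: k => [|k IHk]; first by rewrite !expr0 mul1mx mulmx1.
  by rewrite !exprSr -mulmxA HW mulmxA IHk -mulmxA.
exists (char_poly N); first exact: char_poly_monic.
rewrite -[LHS]mulmx1 -WC mulmxA mulmx_suml.
transitivity (W *m map_mx base_map (\sum_(j < size (char_poly N)) (char_poly
  N)`_j *: N ^+ j) *m C).
  congr (_ *m C); rewrite map_mx_sum mulmx_sumr; apply: eq_bigr => j _.
  rewrite map_mxZ -scalemx_central_Ar; last exact: base_map_center.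
  rewrite -scalemxAl HkW; congr (_ *: (_ *m _)).
  by elim: (nat_of_ord j) => [|k IHk];
    rewrite ?expr0 ?map_mx1 // !exprS map_mxM IHk.
by rewrite Cayley_Hamilton_sum // map_mx0 mulmx0 mul0mx.
Qed.

(* L[c] is an order containing L. *)
Lemma maximal_order_integral L (c : A) (q : {poly o}) :
  is_maximal_order L -> ring_center [set: A] c -> q \is monic ->
  \sum_(j < size q) base_map q`_j * c ^+ j = 0 -> L c.
Proof.
move=> [oL maxL] [_ cc] mq qc; have [[L1 LB LM] [g Dg] spanL] := oL.
pose L2 := [set y | exists P : {poly A}, (forall i, L P`_i) /\ y = P.[c]].
have subL : L `<=` L2.
  move=> x Lx; exists x%:P; split; last by rewrite hornerC.
  by move=> i; rewrite coefC; case: eqP => // _; apply: order0.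
have L2c : L2 c.
  exists 'X; split; last by rewrite hornerX.
  by move=> i; rewrite coefX; case: eqP => // _; apply: order0.
suff oL2 : is_order L2 by rewrite -(maxL L2).
have L2B x y : L2 x -> L2 y -> L2 (x - y).
  move=> [P [LP ->]] [Q [LQ ->]]; exists (P - Q); split;
    last by rewrite hornerD hornerN.
  by move=> i; rewrite coefB; apply: LB.
have L2M x y : L2 x -> L2 y -> L2 (x * y).
  move=> [P [LP ->]] [Q [LQ ->]]; exists (P * Q); split.
    by move=> i; rewrite coefM; apply: big_ind => [|u v|j _]; [exact:
      order0|exact: orderD|exact: LM].
  by rewrite hornerM_comm // /comm_poly cc.
split; first by split=> //; apply: subL.
- pose d := (size q).-1.
  (* [q] is monic of degree [d], so the powers of [c] below [d] suffice. *)
  pose G := [seq x * c ^+ k | x <- g, k <- iota 0 d].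
  exists G; apply/seteqP; split; last first.
    apply: gen_span_sub =>
      [|y z L2y L2z|s x [r _ <-] /allpairsP[[y k] [/= gy _ ->]]].
    + by apply: subL; apply: order0.
    + have -> : y + z = y - (0 - z) by rewrite sub0r opprK.
      by apply: (L2B) => //; apply: (L2B) => //; apply: subL; apply: order0.
    + apply: (L2M); first by apply: subL; apply: order_base.
      apply: (L2M).
        apply: subL; rewrite Dg -[y]mul1r; apply: gen_spanM => //.
        by exists 1 => //; rewrite rmorph1 scale1r.
      by elim: k => [|k IHk]; rewrite ?expr0 ?exprS; [apply: subL|apply: (L2M)].
  move=> y [P [LP ->]]; rewrite horner_coef; apply: gen_span_sum => i.
  move: (LP i); move: (nat_of_ord i) (P`_i) => k l {i LP P}.
  (* Strong induction on the exponent: [c ^+ d] is replaced by lower powers with coefficients in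
     [L]. *)
  have [n] := ubnP k; elim: n k l => // n IHn k l ltkn Ll.
  have [ltkd|ledk] := ltnP k d.
    move: Ll; rewrite Dg; move: l; apply: gen_span_sub =>
      [|x z Gx Gz|s x Ks gx].
    + by rewrite mul0r; apply: gen_span0.
    + by rewrite mulrDl; apply: gen_spanD.
    + rewrite -mulrA; apply: gen_spanM => //=.
      by apply/allpairsP; exists (x, k); rewrite mem_iota.
  have szq : size q = d.+1 by rewrite prednK // size_poly_gt0 monic_neq0.
  have : c ^+ d = - \sum_(j < d) base_map q`_j * c ^+ j.
    move: qc; rewrite szq big_ord_recr /= -[q`_d]/(lead_coef q) (monicP mq)
      rmorph1 mul1r.
    by move/eqP; rewrite addrC addr_eq0 => /eqP.
  move=> Ecd; rewrite -(subnKC ledk) exprD Ecd mulNr mulrN mulr_suml -mulrN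
    -sumrN mulr_sumr.
  apply: gen_span_sum => j.
  rewrite -mulrA -exprD -mulNr mulrA; apply: IHn.
    rewrite -ltnS (leq_trans _ ltkn) // ltnS; have := ltn_ord j.
    by rewrite -(ltn_add2r (k - d)) subnKC.
  by apply: LM => //; apply: orderN => //; apply: order_base.
apply/seteqP; split=> // x _; have : [set: A] x by [].
rewrite -spanL; apply: gen_span_sub => [||s y Ks Ly]; first exact: gen_span0.
  exact: gen_spanD.
by apply: gen_spanM => //; apply: subL.
Qed.

End Orders.

(** * Idempotents in semisimple algebras *)

Lemma span_of_submodule (F : fieldType) (V : vectType F) (P : set V) :
  P 0 -> (forall x y, P x -> P y -> P (x + y)) ->
  (forall k x, P x -> P (k *: x)) ->
  exists U : {vspace V}, forall x, x \in U <-> P x.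
Proof.
move=> P0 PD PZ.
pose Q d := `[< exists U :
  {vspace V}, (forall x, x \in U -> P x) /\ \dim U = d >].
have exQ : exists d, Q d.
  exists 0%N; apply/asboolP; exists 0%VS; split; last exact: dimv0.
  by move=> x; rewrite memv0 => /eqP ->.
have leQ d : Q d -> (d <= \dim {:V})%N.
  by move=> /asboolP[U [_ <-]]; apply: dimvS; apply: subvf.
(* A subspace of maximal dimension inside [P] is not enlarged by adding a line of [P]. *)
case: (ex_maxnP exQ leQ) => d /asboolP[U [UP dU]] maxU.
exists U => x; split=> [|Px]; first exact: UP.
have /asboolP/maxU led : exists U' : {vspace V},
    (forall x, x \in U' -> P x) /\ \dim U' = \dim (U + <[x]>).
  exists (U + <[x]>)%VS; split=> // y /memv_addP[u /UP Pu [w /vlineP[k ->] ->]].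
  by apply: PD => //; apply: PZ.
rewrite -dU in led.
have /eqP -> : (U == U + <[x]>)%VS by rewrite eqEdim addvSl.
by apply: (subvP (addvSr _ _)); apply: memv_line.
Qed.

Section Semisimple.
Variables (F : fieldType) (A : falgType F).
Hypothesis ssA : semisimple A.

(** With [W] a complementary left ideal and [1 = e + w], the element [x - x e = x w] lies in both
    ideals and vanishes. *)
Lemma left_ideal_idempotent (P : set A) :
  P 0 -> (forall x y, P x -> P y -> P (x + y)) ->
  (forall a x, P x -> P (a * x)) ->
  exists2 e, P e & forall x, P x -> x * e = x.
Proof.
move=> P0 PD PM.
have [|U UP] := span_of_submodule P0 PD.
  by move=> k x Px; rewrite -mulr_algl; apply: PM.
have [|W [AW UW UW0]] := ssA (U := U).
  by apply/prodvP => a x _ /UP Px; apply/UP/PM.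
have : 1 \in (U + W)%VS by rewrite UW memvf.
case/memv_addP => e Ue [w Ww E1]; exists e; first exact/UP.
move=> x Px; apply/eqP; rewrite eq_sym -subr_eq0 -memv0 -UW0 memv_cap.
have Pxe : x * e \in U by apply/UP/PM/UP.
rewrite rpredB //; last exact/UP.
have -> : x - x * e = x * w by rewrite -{1}[x]mulr1 E1 mulrDr addrC addKr.
by apply: (subvP AW); rewrite memv_mul ?memvf.
Qed.

(** A right identity [e] of [I] is also a left identity, so [e y = e y e = y e] for every [y]. *)
Lemma ideal_central_idempotent (I : set A) :
  I 0 -> (forall x y, I x -> I y -> I (x + y)) ->
  (forall a x, I x -> I (a * x)) -> (forall a x, I x -> I (x * a)) ->
  exists e, [/\ I e, ring_center [set: A] e & forall x, I x -> x * e = x].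
Proof.
move=> I0 ID IMl IMr.
have [e Ie Ke] := left_ideal_idempotent I0 ID IMl.
have IB x y : I x -> I y -> I (x - y).
  by move=> Ix Iy; apply: ID => //; rewrite -mulN1r; apply: IMl.
(* A y is generated by an idempotent a y, but (y a) y = (y a e) y = 0. *)
have lK y : I y -> e * y = 0 -> y = 0.
  move=> Iy ey.
  have [_ [a ->] Kf] : exists2 f, (exists a, f = a * y) &
      forall x, (exists a, x = a * y) -> x * f = x.
    apply: left_ideal_idempotent; first by exists 0; rewrite mul0r.
      by move=> _ _ [a ->] [b ->]; exists (a + b); rewrite mulrDl.
    by move=> a _ [b ->]; exists (a * b); rewrite mulrA.
  have yy : y * (a * y) = y by apply: Kf; exists 1; rewrite mul1r.
  by rewrite -[LHS]yy mulrA -(Ke (y * a)); [rewrite -mulrA ey mulr0 | exact: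
    IMr].
have eK y : I y -> e * y = y.
  move=> Iy; apply/eqP; rewrite eq_sym -subr_eq0; apply/eqP/lK;
    first exact/IB/IMl.
  by rewrite mulrBr mulrA Ke // subrr.
exists e; split=> //; split=> // y _.
rewrite -[LHS]Ke; last exact: IMr.
by rewrite -mulrA eK //; apply: IMl.
Qed.

(* ker phi = A f with f a central idempotent, and f e = 0 since e is primitive
   and phi e <> 0. *)
Lemma rmorph_inj_component (R : pzRingType) (phi : {rmorphism A -> R}) (e x : A) :
  (1 : R) != 0 -> central_prim_idem A e -> phi e = 1 -> e * x = x -> phi x = 0
    -> x = 0.
Proof.
move=> nz1 [[_ ce] ee e0 prim_e] phie ex phix.
have [||||f [/= f0 [_ cf] Kf]] := ideal_central_idempotent (I :=
  [set y | phi y = 0]).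
- by rewrite /= rmorph0.
- by move=> y z /= y0 z0; rewrite rmorphD y0 z0 addr0.
- by move=> a y /= y0; rewrite rmorphM y0 mulr0.
- by move=> a y /= y0; rewrite rmorphM y0 mul0r.
have ff : f * f = f by apply: Kf.
case: (prim_e (f * e)).
- by split=> // y _; rewrite -mulrA ce // mulrA cf // mulrA.
- by rewrite -mulrA [e * _]mulrA ce // -!mulrA ee [f * (f * e)]mulrA ff.
- by rewrite -mulrA ee.
- by move=> fe0; rewrite -(Kf x) // -{1}ex -mulrA -cf // mulrA ce // fe0 mul0r.
- move=> fe; have := phie; rewrite -fe rmorphM f0 mul0r => /esym/eqP.
  by rewrite (negPf nz1).
Qed.

End Semisimple.

(** If [e] lay in the span of the others, left multiplication by [e] would kill it, whereas
    [e e = e] is nonzero. *)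
Lemma orthogonal_idempotents_free (F : fieldType) (A : falgType F) (X : seq A) :
  uniq X -> (forall e, e \in X -> e != 0 /\ e * e = e) ->
  (forall e f, e \in X -> f \in X -> e != f -> e * f = 0) -> free X.
Proof.
elim: X => [|e X IHX] /=; first by rewrite nil_free.
move=> /andP[eX uX] idX orX; rewrite free_cons IHX //; last 2 first.
- by move=> f fX; apply: idX; rewrite in_cons fX orbT.
- by move=> f g fX gX; apply: orX; rewrite in_cons (fX, gX) orbT.
rewrite andbT; have [e0 ee] := idX e (mem_head _ _); apply: contra e0 => eX'.
have : (<<X>> <= lker (amull e))%VS.
  apply/span_subvP => f fX; rewrite memv_ker lfunE /= orX ?mem_head //.
    by rewrite in_cons fX orbT.
  by apply: contraNneq eX => ->.
by move=> /subvP/(_ e eX'); rewrite memv_ker lfunE /= ee.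
Qed.

(** Distinct central primitive idempotents are orthogonal, hence independent, so [\dim {:A}] bounds
    their number. This turns [red_norm] and [gen_adjoint] into genuine finite sums. *)
Lemma finite_central_prim_idem (F : fieldType) (A : falgType F) :
  finite_set (central_prim_idem A).
Proof.
apply: contrapT => /(infinite_set_fset (\dim {:A}).+1)[B BP].
apply/negP; rewrite -leqNgt.
have : free (finmap.enum_fset B).
  apply: orthogonal_idempotents_free; first exact: finmap.fset_uniq.
    by move=> e /BP[].
  move=> e f /BP[[_ ce] ee e0 prim_e] /BP[[_ cf] ff f0 prim_f] nef.
  have cef : ring_center [set: A] (e * f).
    by split=> // y _; rewrite -mulrA cf // !mulrA ce.
  have idef : e * f * (e * f) = e * f.
    by rewrite -mulrA [f * _]mulrA cf // -!mulrA ff mulrA ee.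
  have [//|Ee] : e * f = 0 \/ e * f = e.
    by apply: prim_e => //; rewrite -mulrA cf // mulrA ee.
  have [//|Ef] : e * f = 0 \/ e * f = f.
    by apply: prim_f => //; rewrite -mulrA ff.
  by rewrite -Ee Ef eqxx in nef.
rewrite /free => /eqP <-; exact: dimvS (subvf _).
Qed.

Lemma scalar_mx_rmorphism (R : nzRingType) (E : fieldType) (m : nat)
    (g : {rmorphism R -> 'M[E]_m}) :
  (0 < m)%N -> (forall r, is_scalar_mx (g r)) ->
  exists psi : {rmorphism R -> E}, forall r, g r = (psi r)%:M.
Proof.
case: m g => // m g _ gs.
pose psi r := g r ord0 ord0.
have Dg r : g r = (psi r)%:M.
  by have /is_scalar_mxP[a Da] := gs r; rewrite /psi Da mxE eqxx mulr1n.
have psiB : zmod_morphism psi by move=> x y; rewrite /psi rmorphB !mxE.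
have psiM : monoid_morphism psi.
  split; first by rewrite /psi rmorph1 mxE eqxx.
  by move=> x y; rewrite {1}/psi rmorphM !Dg -[_ * _]/(_ *m _) -scalar_mxM mxE
    eqxx mulr1n.
pose psiZ := GRing.isZmodMorphism.Build _ _ psi psiB.
pose psiR := GRing.isMonoidMorphism.Build _ _ psi psiM.
pose psi' : {rmorphism R -> E} := HB.pack psi psiZ psiR.
by exists psi'.
Qed.

(** * Extending a representation of [A] to matrices over [A] *)

Section BlockMap.
Variables (A : nzRingType) (E : fieldType) (m : nat).
Variable phi : {rmorphism A -> 'M[E]_m}.

(** The block matrix whose characteristic polynomial occurs in [is_red_char_poly]. *)
Definition block_map (b : nat) (H : 'M[A]_b) : 'M[E]_(\sum_(i < b) m) :=
  \mxblock_(i < b, k < b) phi (H i k).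

Lemma block_map_sum (b : nat) (I : finType) (H : I -> 'M[A]_b) :
  block_map (\sum_i H i) = \sum_i block_map (H i).
Proof.
rewrite -mxblock_sum; apply: eq_mxblock => i k.
by rewrite summxE rmorph_sum.
Qed.

Lemma block_mapM (b : nat) (H G : 'M[A]_b) :
  block_map (H *m G) = block_map H *m block_map G.
Proof.
rewrite /block_map mul_mxblock; apply: eq_mxblock => i k.
by rewrite mxE rmorph_sum; apply: eq_bigr => j _; rewrite rmorphM.
Qed.

Lemma block_map1 (b : nat) : block_map (1%:M : 'M[A]_b) = 1%:M.
Proof.
(* Multiplying by an identity matrix cut into blocks avoids computing these blocks: block row [i] of
   the product just selects block row [i]. *)
rewrite -[LHS]mulmx1 -[X in _ *m X](@submxblockK _ _ _ (fun=> m) (fun=> m)).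
rewrite /block_map mul_mxblock -[RHS](@submxblockK _ _ _ (fun=> m) (fun=> m)).
apply: eq_mxblock => i k; rewrite (bigD1 i) //= mxE eqxx rmorph1 mul1mx.
rewrite [X in _ + X]big1 ?addr0 // => j /negPf ji;
  rewrite mxE eq_sym ji rmorph0.
exact: mul0mx.
Qed.

Lemma block_mapX (b : nat) (H : 'M[A]_b) (k : nat) :
  block_map (H ^+ k) = block_map H ^+ k.
Proof. by elim: k => [|k IHk];
  rewrite ?expr0 ?block_map1 // !exprS block_mapM IHk. Qed.

Lemma block_mapZ (b : nat) (c : A) (a : E) (H : 'M[A]_b) :
  phi c = a%:M -> block_map (c *: H) = a *: block_map H.
Proof.
move=> Dc; apply/matrixP => s t; rewrite !mxE rmorphM Dc.
by rewrite -[LHS]/(((a%:M : 'M_m) *m _) _ _) mul_scalar_mx mxE.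
Qed.

Lemma block_map0 (b : nat) : block_map (0 : 'M[A]_b) = 0.
Proof. by rewrite -(scale0r 0) (block_mapZ (a :=
  0)) ?scale0r // rmorph0 raddf0. Qed.

Lemma block_map_eq0 (b : nat) (H : 'M[A]_b) i k : block_map H = 0 -> phi (H i k) = 0.
Proof. by rewrite -(mxblock0 (p_ := fun=> m)) /block_map =>
  /eq_mxblockP/(_ i k). Qed.

End BlockMap.

(** * Reduced Cayley-Hamilton and the generalised adjoint *)

Section ReducedCharPoly.
Variables (F : fieldType) (A : falgType F).
Hypothesis ssA : semisimple A.

(** [m = 0] would give [A e] dimension 0, but it contains [e]. *)
Lemma splitting_repr_gt0 (e : A) (E : fieldType) (m : nat)
    (phi : {rmorphism A -> 'M[E]_m}) :
  central_prim_idem A e -> splitting_repr e phi -> (0 < m)%N.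
Proof.
move=> [_ _ e0 _] [_ _ _ dimE]; rewrite lt0n; apply: contraNneq e0 => m0.
rewrite m0 mul0n in dimE; move/eqP: dimE; rewrite dimv_eq0 => /eqP eA0.
have : e * 1 \in (<[e]> * fullv)%VS by rewrite memv_mul ?memv_line ?memvf.
by rewrite eA0 memv0 mulr1.
Qed.

Lemma splitting_repr_inj (e x : A) (E : fieldType) (m : nat)
    (phi : {rmorphism A -> 'M[E]_m}) :
  central_prim_idem A e -> splitting_repr e phi ->
  e * x = x -> phi x = 0 -> x = 0.
Proof.
move=> cpe spl; have [phie _ _ _] := spl; apply: rmorph_inj_component => //.
have := splitting_repr_gt0 cpe spl; case: (m) => // m' _.
exact: oner_neq0.
Qed.

Lemma red_char_polyP (e : A) (b : nat) (H : 'M[A]_b) :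
  red_char_poly e H = 0 \/ is_red_char_poly e H (red_char_poly e H).
Proof. by rewrite /red_char_poly; case: xgetP => [f _|]; [right|left]. Qed.

Lemma red_char_poly_central (e : A) (b : nat) (H : 'M[A]_b) (j : nat) :
  ring_center [set: A] (red_char_poly e H)`_j /\
  (red_char_poly e H)`_j * e = (red_char_poly e H)`_j.
Proof.
case: (red_char_polyP e H) => [->|[E [m [phi [_ /(_ j)[]]]]]] //.
rewrite coef0 mul0r; split=> //; split=> // y _.
by rewrite mul0r mulr0.
Qed.

(** [c] absorbs every factor [e]; for [k = 0] both powers are the identity of [M_b(A)]. *)
Lemma scalemx_idemX (c e : A) (b : nat) (H : 'M[A]_b) (k : nat) :
  ring_center [set: A] e -> c * e = c -> c *: (e *: H) ^+ k = c *: H ^+ k.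
Proof.
move=> ce ceE; elim: k => [|k IHk] //.
rewrite !exprSr -[X in _ *: X]/(_ *m _) -scalemx_central_Ar // scalerA ceE.
by rewrite scalemxAl IHk -scalemxAl.
Qed.

(** [phi] turns the sum into the characteristic polynomial of the block matrix evaluated at that
    matrix; the entries lie in [A e], where [phi] is injective. *)
Lemma reduced_Cayley_Hamilton (e : A) (b : nat) (H : 'M[A]_b) :
  central_prim_idem A e ->
  \sum_(j < size (red_char_poly e H)) (red_char_poly e H)`_j *: (e *:
    H) ^+ j = 0.
Proof.
move=> cpe; have [ce ee e0 _] := cpe; set f := red_char_poly e H.
have fc := red_char_poly_central e H.
case: (red_char_polyP e H) => [f0|[E [m [phi [spl Df]]]]].
  by rewrite big1 // => -[j /= _] _; rewrite /f f0 coef0 scale0r.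
have {}Df j : phi f`_j = ((char_poly (block_map phi H))`_j)%:M by case: (Df j).
rewrite -/f in Df fc.
transitivity (\sum_(j < size f) f`_j *: H ^+ j).
  by apply: eq_bigr => j _; apply: scalemx_idemX => //; case: (fc j).
pose d := maxn (size f) (size (char_poly (block_map phi H))).
have -> : \sum_(j < size f) f`_j *: H ^+ j = \sum_(j < d) f`_j *: H ^+ j.
  rewrite (big_ord_widen d (fun j => f`_j *: H ^+ j)) ?leq_maxl // big_mkcond.
  by apply: eq_bigr => j _; case: ltnP => // /(nth_default 0) ->;
    rewrite scale0r.
have E0 : block_map phi (\sum_(j < d) f`_j *: H ^+ j) = 0.
  rewrite block_map_sum.
  rewrite -[RHS](Cayley_Hamilton_sum (N :=
    block_map phi H) (leq_maxr (size f) _)).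
  by apply: eq_bigr => j _; rewrite (block_mapZ _ (Df j)) block_mapX.
apply/matrixP => i k; rewrite [RHS]mxE.
apply: (splitting_repr_inj cpe spl); last exact: block_map_eq0 E0.
rewrite summxE mulr_sumr; apply: eq_bigr => j _; rewrite mxE mulrA.
by have [_ ->] := ce; rewrite ?(fc j).2.
Qed.

(** Isolate the constant term in the reduced Cayley-Hamilton identity and factor [H] out of the
    rest; the sign turns [- f_0] into the reduced norm. *)
Lemma gen_adjoint_compM (e : A) (b : nat) (H : 'M[A]_b) :
  central_prim_idem A e -> gen_adjoint_comp e H *m H = (red_norm_comp e H)%:M.
Proof.
move=> cpe; have [ce _ _ _] := cpe; have := reduced_Cayley_Hamilton H cpe.
rewrite /gen_adjoint_comp /red_norm_comp /red_deg.
have := red_char_poly_central e H; move: (red_char_poly e H) => f fc fH.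
set d := (size f).-1.
(* For [f = 0] the bound [d.+1 = 1] differs from the size of [f], so this case is separate. *)
have : \sum_(j < d.+1) f`_j *: (e *: H) ^+ j = 0.
  have [f0|f0] := eqVneq f 0; last by rewrite prednK // size_poly_gt0.
  by rewrite big1 // => -[j /= _] _; rewrite f0 coef0 scale0r.
rewrite big_ord_recl expr0 => /eqP; rewrite addrC addr_eq0 => /eqP sumf.
rewrite -scalemxAl mulmx_suml big_add1 big_mkord.
have -> : \sum_(i < d) f`_i.+1 *: (e *: H) ^+ i.+1.-1 *m H = - (f`_0 *: (1 :
  'M[A]_b)).
  rewrite -sumf; apply: eq_bigr => j _ /=.
  rewrite -scalemxAl exprSr -[X in _ = _ *: X]/(_ *m _) -scalemx_central_Ar //.
  by rewrite scalerA (fc _).2.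
by rewrite scalerN -scaleNr exprS mulN1r opprK scalerA -[RHS]scalemx1.
Qed.

Lemma gen_adjointM (b : nat) (H : 'M[A]_b) :
  gen_adjoint H *m H = (red_norm H)%:M.
Proof.
have fin := finite_central_prim_idem A.
rewrite /gen_adjoint /red_norm !fsbig_finite // mulmx_suml raddf_sum.
apply: eq_big_seq => e; rewrite in_fset_set // inE => cpe.
exact: gen_adjoint_compM.
Qed.

End ReducedCharPoly.

(** * Integrality of reduced characteristic polynomials *)

Section ReducedIntegrality.
Variables (o : idomainType) (A : falgType {fraction o}) (L L' : set A).
Hypotheses (ssA : semisimple A) (oL : is_order L).

(** The monic equation of [H] over [o] passes to the block matrix, whose characteristic polynomial
    then has integral coefficients; injectivity of [phi] on [A e] brings their equations back to
    [A]. *)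
Lemma red_char_poly_integral (e : A) (b : nat) (H : 'M[A]_b) (j : nat) :
  central_prim_idem A e -> mx_over L H ->
  exists2 q : {poly o}, q \is monic &
    \sum_(k < size q) base_map A q`_k * (red_char_poly e H)`_j ^+ k = 0.
Proof.
move=> cpe LH; have [ce _ _ _] := cpe.
have [[_ fc] fe] := red_char_poly_central e H j.
set f := red_char_poly e H in fc fe *.
case: (red_char_polyP e H) => [f0|[E [m [phi [spl Df]]]]].
  exists 'X; first exact: monicX.
  by rewrite size_polyX !big_ord_recl big_ord0 /f f0 !coef0 !coefX /= expr1
    mulr0 rmorph0 mul0r !addr0.
have {}Df : phi f`_j = ((char_poly (block_map phi H))`_j)%:M by case: (Df j).
have [phie phis _ _] := spl.
(* [phi] sends [o] to scalars, which makes [E] an [o]-algebra through [psi]. *)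
have [psi Dpsi] : exists psi : {rmorphism o -> E},
    forall r, phi (base_map A r) = (psi r)%:M.
  apply: (@scalar_mx_rmorphism _ _ _ (phi \o base_map A)); first exact:
    splitting_repr_gt0 cpe spl.
  by move=> r; apply: phis; apply: base_map_center.
have [q mq qH] := order_mx_integral oL LH.
have [|r mr /rootP rr] := integral_char_poly (psi := psi) (N :=
  block_map phi H) mq _ j.
  transitivity (block_map phi (\sum_(k < size q) base_map A q`_k *: H ^+ k)).
    by rewrite block_map_sum; apply: eq_bigr => k _;
      rewrite (block_mapZ _ (Dpsi _)) block_mapX.
  by rewrite qH block_map0.
(* r only kills f_j inside the component A e, whose unit is e rather than 1;
   the factor 'X makes the equation hold in A. *)
exists (r * 'X); first by rewrite monicMr ?monicX.
rewrite size_mulX ?monic_neq0 // big_ord_recl coefMX /= rmorph0 mul0r add0r.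
set y := \sum_(k < size r) base_map A r`_k * f`_j ^+ k.
transitivity (f`_j * y).
  rewrite mulr_sumr; apply: eq_bigr => k _; rewrite coefMX /= exprS.
  by rewrite !mulrA; congr (_ * _); rewrite fc.
apply: (splitting_repr_inj ssA cpe spl).
  by rewrite mulrA; have [_ ->] := ce; rewrite ?fe.
rewrite rmorphM; suff -> : phi y = 0 by rewrite mulr0.
rewrite /y rmorph_sum -[RHS](raddf0 (@scalar_mx E m)) -[in RHS]rr.
rewrite (@horner_coef_wide _ (size r)) ?size_poly // raddf_sum.
apply: eq_bigr => k _ /=; rewrite coef_map /= rmorphM Dpsi scalar_mxM.
congr (_ *m _); elim: (nat_of_ord k) => [|i IHi];
  first by rewrite !expr0 rmorph1.
by rewrite !exprS rmorphM scalar_mxM IHi Df.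
Qed.

Hypothesis mL' : is_maximal_order L'.

Lemma red_char_poly_center (e : A) (b : nat) (H : 'M[A]_b) (j : nat) :
  central_prim_idem A e -> mx_over L H -> ring_center L' (red_char_poly e H)`_j.
Proof.
move=> cpe LH; have [cf _] := red_char_poly_central e H j.
have [q mq qf] := red_char_poly_integral j cpe LH.
apply/(order_center _ mL'.1); split=> //.
exact: maximal_order_integral mL' cf mq qf.
Qed.

End ReducedIntegrality.

(** * Closure properties of orders and their centres *)

Section Centers.
Variables (o : idomainType) (A : falgType {fraction o}) (L : set A).
Hypothesis oL : is_order L.

Lemma ring_center0 : ring_center L 0.
Proof. by split=> [|y _]; [exact: order0 | rewrite mul0r mulr0]. Qed.

Lemma ring_centerD x y : ring_center L x -> ring_center L y -> ring_center L (x + y).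
Proof.
move=> [Lx cx] [Ly cy]; split=> [|z Lz]; first exact: orderD.
by rewrite mulrDl mulrDr cx // cy.
Qed.

Lemma ring_centerM x y : ring_center L x -> ring_center L y -> ring_center L (x * y).
Proof.
have [[_ _ LM] _ _] := oL.
move=> [Lx cx] [Ly cy]; split=> [|z Lz]; first exact: LM.
by rewrite -mulrA cy // !mulrA cx.
Qed.

Lemma ring_center_sign (n : nat) : ring_center L ((-1) ^+ n).
Proof.
have [[L1 _ LM] _ _] := oL.
elim: n => [|n IHn]; first by rewrite expr0; split=> // y _;
  rewrite mul1r mulr1.
rewrite exprS; apply: ring_centerM => //; split; first exact: orderN.
by move=> y _; rewrite mulN1r mulrN1.
Qed.

Lemma mx_over_sum (m n : nat) (I : Type) (r : seq I) (P : pred I)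
    (H : I -> 'M[A]_(m, n)) :
  (forall i, P i -> mx_over L (H i)) -> mx_over L (\sum_(i <- r | P i) H i).
Proof.
move=> LH; apply: big_ind => // [|B C LB LC] i j; rewrite mxE; first exact:
  order0.
exact: orderD.
Qed.

Lemma mx_overX (b : nat) (H : 'M[A]_b) (k : nat) : mx_over L H -> mx_over L (H ^+ k).
Proof.
have [[L1 _ LM] _ _] := oL.
move=> LH; elim: k => [|k IHk] i j.
  by rewrite expr0 mxE; case: eqP => // _; exact: order0.
rewrite exprS mxE; apply: big_ind => [|x y Lx Ly|l _]; first exact: order0.
  exact: orderD.
exact: LM.
Qed.

End Centers.

(** * The conductor lies in the adjoint ideal *)

Section Conductor.
Variables (o : idomainType) (A : falgType {fraction o}) (L L' : set A).
Hypotheses (ssA : semisimple A) (oL : is_order L).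
Hypothesis mL' : is_maximal_order L'.

Lemma red_norm_center (b : nat) (H : 'M[A]_b) :
  mx_over L H -> ring_center L' (red_norm H).
Proof.
move=> LH; have oL' := mL'.1; have fin := finite_central_prim_idem A.
rewrite /red_norm fsbig_finite // big_seq; apply: big_ind.
- exact: ring_center0.
- exact: ring_centerD.
move=> e; rewrite in_fset_set // inE => cpe; apply: ring_centerM => //.
  exact: ring_center_sign.
exact: (red_char_poly_center ssA oL mL').
Qed.

Lemma conductorM x y :
  conductor (ring_center L') (ring_center L) x -> ring_center L' y ->
  conductor (ring_center L') (ring_center L) (x * y).
Proof.
have oL' := mL'.1.
move=> [Cx xC] Cy; split; first exact: ring_centerM.
by move=> z Cz; rewrite -mulrA; apply/xC/ring_centerM.
Qed.

Lemma conductor_adjoint_ideal :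
  conductor (ring_center L') (ring_center L) `<=` adjoint_ideal L.
Proof.
have oL' := mL'.1; have fin := finite_central_prim_idem A.
have [[_ _ LM] _ _] := oL; have [[L'1 _ _] _ _] := oL'.
move=> x [Cx xC]; split.
  (* [1] lies in the centre of [L'], so [x = x 1] lies in that of [L]. *)
  by rewrite -[x]mulr1; apply: xC; split=> // y _; rewrite mul1r mulr1.
move=> b H LH; rewrite /gen_adjoint fsbig_finite // scaler_sumr big_seq.
apply: mx_over_sum => // e; rewrite in_fset_set // inE => cpe.
rewrite /gen_adjoint_comp scalerA scaler_sumr; apply: mx_over_sum => // j _.
have [_ fe] := red_char_poly_central e H j; have [ce _ _ _] := cpe.
(* [e *: H] need not have entries in [L]; since the coefficient absorbs [e], powers of [H] itself
   can be used. *)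
rewrite scalemx_idemX // scalerA => i k; rewrite mxE; apply: LM; last exact:
  mx_overX.
rewrite -mulrA; have [//|//] :=
  xC ((-1) ^+ (red_deg e H).+1 * (red_char_poly e H)`_j).
apply: ring_centerM => //; first exact: ring_center_sign.
exact: (red_char_poly_center ssA oL mL').
Qed.

End Conductor.

(** * Annihilation of the module *)

Section Annihilator.
Variables (o : idomainType) (A : falgType {fraction o}) (Lam : nzRingType).
Variables (iota : {rmorphism Lam -> A}) (L' : set A) (M : lmodType Lam).
Hypotheses (ssA : semisimple A) (inj_iota : injective iota).
Hypotheses (oL : is_order (range iota)) (mL' : is_maximal_order L').
Hypothesis LL' : range iota `<=` L'.

Let cond := conductor (ring_center L') (ring_center (range iota)).

Lemma center_annihilator0 : center_annihilator iota M 0.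
Proof.
exists 0; last exact: rmorph0.
by split=> [|x]; [split=> // y _; rewrite mul0r mulr0 | rewrite scale0r].
Qed.

Lemma center_annihilatorD x y :
  center_annihilator iota M x -> center_annihilator iota M y ->
  center_annihilator iota M (x + y).
Proof.
move=> [z [[_ cz] z0] <-] [w [[_ cw] w0] <-]; exists (z + w); last exact:
  rmorphD.
split=> [|v]; first by split=> // v _; rewrite mulrDl mulrDr cz // cw.
by rewrite scalerDl z0 w0 addr0.
Qed.

(* c nr(H) 1_b = (c H^* ) H with c H^* over Lam, so c nr(H) maps every row vector
   into the row space of h. *)
Lemma conductor_minor_annihilates (a b : nat) (h : 'M[Lam]_(a, b))
    (s : 'I_b -> 'I_a) (c : A) :
  presents M h -> cond c ->
  center_annihilator iota M (c * red_norm (map_mx iota (rowsub s h))).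
Proof.
move=> [p [p_onto p_ker]] Cc; set H := map_mx iota (rowsub s h).
have LH : mx_over (range iota) H by move=> i j; rewrite mxE;
  exists (rowsub s h i j).
have [_ /(_ _ _ LH) LG] := conductor_adjoint_ideal ssA oL mL' Cc.
have /choice[G DG] (ij : 'I_b * 'I_b) :
    exists g, iota g = (c *: gen_adjoint H) ij.1 ij.2.
  by have [g _ <-] := LG ij.1 ij.2; exists g.
(* [z] lifts [c nr(H)] to [Lam]; the conductor property also makes it central. *)
have [[z _ Dz] cz] := Cc.2 _ (red_norm_center ssA oL mL' LH).
have DzM : (\matrix_(i, j) G (i, j)) *m rowsub s h = z%:M.
  apply/matrixP => i j; apply: inj_iota.
  transitivity (((c *: gen_adjoint H) *m H) i j).
    rewrite !mxE rmorph_sum; apply: eq_bigr => k _.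
    by rewrite !mxE rmorphM DG mxE.
  rewrite -scalemxAl gen_adjointM // !mxE mulrnAr -Dz.
  by rewrite -rmorphMn.
have cenz : ring_center [set: Lam] z.
  split=> // y _; apply: inj_iota; rewrite !rmorphM Dz.
  by apply: cz; exists y.
exists z => //; split=> // x; have [v <-] := p_onto x.
rewrite -linearZ; apply/p_ker.
(* [z v = v G (rowsub s h)], and [rowsub s 1%:M] writes the chosen rows as a matrix times [h]. *)
exists (v *m (\matrix_(i, j) G (i, j)) *m rowsub s 1%:M).
rewrite -mulmxA -rowsubE -mulmxA DzM.
by rewrite -[v in LHS]mulmx1 scalemx_central_Ar // scalemx1.
Qed.

(** For a generator [u nr(H)], the scalar [u] lies in the centre of [L'], so [c u] is again in the
    conductor and the case of a single minor applies. *)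
Lemma conductor_Fit_pres (a b : nat) (h : 'M[Lam]_(a, b)) (c x : A) :
  presents M h -> cond c -> Fit_pres iota h x ->
  center_annihilator iota M (c * x).
Proof.
move=> Mh Cc; rewrite /Fit_pres; case: leqP => _; last first.
  by move=> ->; rewrite mulr0; exact: center_annihilator0.
move: x; apply: (gen_span_sub (T :=
  [set x | center_annihilator iota M (c * x)])).
- by rewrite /= mulr0; exact: center_annihilator0.
- by move=> y z /= cy cz; rewrite mulrDr; apply: center_annihilatorD.
move=> u _ Uu [s [_ ->]] /=; rewrite mulrA.
apply: conductor_minor_annihilates => //; apply: conductorM => //.
have oL' := mL'.1.
move: u Uu; apply: gen_span_sub => [||u _ Zu [b' [H [[LH _] ->]]]].
- exact: ring_center0.
- exact: ring_centerD.
- apply: ring_centerM => //; last exact: (red_norm_center ssA oL mL' LH).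
  by have [Lu cu] := (order_center _ oL).1 Zu; apply/(order_center _ oL');
    split=> //; apply: LL'.
Qed.

(** [Fit_max] is either [Fit_pres] of some presentation or the default [[set 0]]. *)
Lemma conductor_Fit_max :
  gen_span cond (Fit_max iota M) `<=` center_annihilator iota M.
Proof.
apply: gen_span_sub => [|x y|c x Cc]; first exact: center_annihilator0.
  exact: center_annihilatorD.
rewrite /Fit_max; case: xgetP => [I _ [[a [b [h [Mh ->]]]] _]|_ ->].
  exact: conductor_Fit_pres.
by rewrite mulr0; exact: center_annihilator0.
Qed.

End Annihilator.

Theorem proposition6p4 (o : idomainType) (A : falgType {fraction o})
    (Lam : nzRingType) (iota : {rmorphism Lam -> A}) (Lam' : set A)
    (M : lmodType Lam) :
  fitting_domain o ->
  separable_algebra A ->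
  injective iota ->
  is_order (range iota) ->
  is_maximal_order Lam' ->
  range iota `<=` Lam' ->
  fg_module M ->
  conductor (ring_center Lam') (ring_center (range iota))
    `<=` adjoint_ideal (range iota) /\
  gen_span (conductor (ring_center Lam') (ring_center (range iota)))
      (Fit_max iota M)
    `<=` center_annihilator iota M.
Proof.
move=> _ [ssA _] inj_iota oL mL' LL' _; split.
  exact: conductor_adjoint_ideal.
exact: conductor_Fit_max.
Qed.
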